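(* Let $p$ be a prime and let $G$ be a finite non-abelian $p$-group of coclass $1$. Then $G$ has a noninner automorphism of order $p$ leaving $\Phi(G)$ elementwise fixed.
   Context: A finite $p$-group $G$ of order $p^n$, $n>2$, is said to be of coclass $c$ if $G$ is nilpotent of class $n-c$. $\Phi(G)$ denotes the Frattini subgroup of $G$. An automorphism leaves a subgroup elementwise fixed if it fixes each of its elements. *)

(* Defs.v *)
From mathcomp Require Import all_boot all_fingroup all_solvable.

Set Implicit Arguments.
Unset Strict Implicit.
Unset Printing Implicit Defensive.

Local Open Scope group_scope.

(* The class n - c is stated additively because subtraction on nat is
   truncated; [nilpotent G] is required because [nil_class G] has the junk
   value #|G| when G is not nilpotent. *)
Definition has_coclass (p c : nat) (gT : finGroupType) (G : {group gT}) : Prop :=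
  exists n : nat, [/\ #|G| = (p ^ n)%N, (2 < n)%N, nilpotent G
                    & (nil_class G + c)%N = n].

Definition Inn (gT : finGroupType) (G : {group gT}) : {set {perm gT}} :=
  conj_aut G @* G.

Definition elementwise_fixes (gT : finGroupType) (a : {perm gT}) (A : {set gT}) : Prop :=
  {in A, forall x, a x = x}.

(* Main.v *)
Require Import Defs.
From mathcomp Require Import all_boot all_fingroup all_solvable.

(** Every automorphism used here is built from a shear: for a normal subgroup N
    of prime index p in G, an element g outside N and c in 'Z(N), the map that
    fixes N pointwise and sends g to g * c is a well defined automorphism as
    soon as (g * c) ^+ p = g ^+ p ([shear_Aut]). It fixes 'Phi(G) because N is
    maximal, and it has order p when c has order p ([order_shear]). Only the
    choice of N and c depends on |G| = p ^ n.

    If n > 3, coclass 1 forces 'Z(G) and 'Z(G / 'Z(G)) to have order p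
    ([card_center_maxclass]). Let y represent a generator of the latter group.
    Some x in G does not commute with y, and x lies in a maximal subgroup N
    because G is not cyclic. The subgroup 'C_G(N) is then just 'Z(G): a larger
    one would, modulo 'Z(G), meet the center of G / 'Z(G), hence contain y,
    which does not centralize x. Take c of order p in N :&: 'Z(G). Conjugation
    by u agrees with the shear only if u centralizes N; such a u is central,
    and its conjugation is trivial, whereas the shear is not.

    If n = 3, G is extraspecial: 'Phi(G), G^`(1) and 'Z(G) coincide and have
    order p. All shears by central elements are inner, so one takes instead c
    outside 'Z(G) = G^`(1); the shear is then noninner because inner
    automorphisms act trivially on G / G^`(1) ([Inn_shear_der1]). For odd p,
    N is elementary abelian of order p ^ 2 and c is any noncentral element of
    N; the identity (g * c) ^+ p = g ^+ p holds since p divides 'C(p, 2). For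
    p = 2, N = <[r]> is cyclic of order 4 and c = r; that shear has order 4,
    but composing it with the conjugation by g, which inverts r, gives an
    involution. *)

Set Implicit Arguments.
Unset Strict Implicit.
Unset Printing Implicit Defensive.

Local Open Scope group_scope.

(** * Shears along a normal subgroup of prime index *)

Lemma Aut_fix_gen_eq1 (gT : finGroupType) (G : {group gT}) (A : {set gT}) a :
  a \in Aut G -> G :=: <<A>> -> {in A, forall x, a x = x} -> a = 1.
Proof.
move=> AutGa defG fixA; apply: (eq_Aut AutGa (group1 _)) => x Gx.
have sAG : A \subset G by rewrite defG subset_gen.
have gF : group_set [set y in G | a y == y].
  apply/group_setP; split=> [|y z].
    by rewrite inE group1 -(autmE AutGa) morph1 eqxx.
  rewrite !inE => /andP[Gy /eqP ay] /andP[Gz /eqP az].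
  by rewrite groupM //= -(autmE AutGa) morphM //= autmE ay az.
have : G \subset Group gF.
  rewrite {1}defG gen_subG; apply/subsetP=> y Ay.
  by rewrite inE (subsetP sAG) //= fixA.
by move/subsetP/(_ x Gx); rewrite inE perm1 => /andP[_ /eqP].
Qed.

(** The shear glues the identity of N with the morphism <[g]> -> <[g * c]>
    sending g to g * c. The two agree on N :&: <[g]> = <[g ^+ p]> because of
    the hypothesis on p-th powers, and they are compatible with conjugation
    because c centralizes N. *)
Lemma shear_Aut (gT : finGroupType) (G N : {group gT}) (g c : gT) :
    N <| G -> prime #|G : N| -> g \in G :\: N -> c \in 'Z(N) ->
    (g * c) ^+ #|G : N| = g ^+ #|G : N| ->
  exists a : {perm gT},
    [/\ a \in Aut G, {in N, forall x, a x = x}, a g = g * c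
      & G :=: <<g |: N>>].
Proof.
move=> /andP[sNG nNG] pr_p /setDP[Gg N'g] /setIP[Nc cNc] gcp.
set p := #|G : N| in pr_p gcp.
have nNg : g \in 'N(N) := subsetP nNG g Gg.
have ocg : #[coset N g] = p.
  apply/prime_nt_dvdP=> //; last first.
    by rewrite /p -card_quotient // order_dvdG // mem_quotient.
  by rewrite order_eq1; apply: contra N'g => /eqP; apply: coset_idr.
(* p is the order of g modulo N, so N :&: <[g]> consists of powers of g ^+ p. *)
have p_dvd i : g ^+ i \in N -> p %| i.
  by move=> Ngi; rewrite -ocg order_dvdn -morphX //= coset_id.
have dvd_gc : #[g * c] %| #[g].
  have /dvdnP[k def_k] : p %| #[g] by apply: p_dvd; rewrite expg_order.
  by rewrite order_dvdn def_k mulnC expgM gcp -expgM mulnC -def_k expg_order.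
have defG : G = (N <*> <[g]>)%G.
  apply/val_inj/eqP; rewrite /= eqEsubset join_subG sNG cycle_subG Gg !andbT.
  have maxN : maximal N G by apply: p_index_maximal.
  have sNgG : N <*> <[g]> \subset G by rewrite join_subG sNG cycle_subG.
  have /maxgroupP[_ maxN'] := maxN; apply: contraR N'g => nGN.
  rewrite -(maxN' (N <*> <[g]>)%G) ?joing_subl //= ?/proper ?sNgG //.
  by rewrite -cycle_subG joing_subr.
have nNK : <[g]> \subset 'N(N) by rewrite cycle_subG.
have actf : {in N & <[g]>, morph_act 'J 'J (idm N) (eltm dvd_gc)}.
  move=> x _ Nx /cycleP[i ->]; rewrite eltmE /=.
  elim: i => [|i IHi]; first by rewrite !conjg1.
  have Nxi : (x ^ (g ^+ i)) ^ g \in N.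
    by rewrite -conjgM -expgSr memJ_norm // groupX.
  rewrite !expgSr conjgM [RHS]conjgM -IHi (conjgM _ g c).
  by rewrite [RHS]conjgE -(centP cNc _ Nxi) mulKg.
have eqf : {in N :&: <[g]>, idm N =1 eltm dvd_gc}.
  move=> x /setIP[Nx /cycleP[i def_x]]; move: Nx; rewrite {x}def_x.
  by move=> /p_dvd/dvdnP[k ->]; rewrite /idm eltmE mulnC !expgM gcp.
pose f := [morphism of pprodm nNK actf eqf].
have fN x : x \in N -> f x = x by move=> Nx; rewrite /= pprodmEl.
have fg : f g = g * c by rewrite /= pprodmEr ?cycle_id //; apply: eltm_id.
have sNJ : N \subset N <*> <[g]> := joing_subl _ _.
have Jg : g \in N <*> <[g]> by rewrite -cycle_subG joing_subr.
(* The image contains N, hence c, and g * c, hence g; being onto, f is also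
   injective. *)
have fG : f @* (N <*> <[g]>) = N <*> <[g]>.
  apply/eqP; rewrite eqEsubset; apply/andP; split.
    have sJ : N <*> <[g]> \subset N * <[g]> by rewrite norm_joinEr.
    apply: subset_trans (morphimS f sJ) _.
    rewrite morphim_pprodm //= morphim_idm // im_eltm mul_subG ?joing_subl //.
    by rewrite cycle_subG groupM // ?(subsetP sNJ).
  have sNf : N \subset f @* (N <*> <[g]>).
    by apply/subsetP=> x Nx; rewrite -(fN x Nx) mem_morphim //= (subsetP sNJ).
  rewrite join_subG sNf cycle_subG -(groupMr _ (subsetP sNf c Nc)) -fg.
  by rewrite mem_morphim //= -cycle_subG joing_subr.
have injf : 'injm f by rewrite -card_im_injm fG.
exists (aut injf fG); split.
- by rewrite defG Aut_aut.
- by move=> x Nx; rewrite autE ?(subsetP sNJ) ?fN.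
- by rewrite autE ?fg.
- by rewrite defG /= joing_idr joingC joingE.
Qed.

(** As c is fixed, iterating the shear k times sends g to g * c ^+ k. *)
Lemma order_shear (gT : finGroupType) (p : nat) (G N : {group gT})
    (g c : gT) (a : {perm gT}) :
    prime p -> a \in Aut G -> G :=: <<g |: N>> ->
    {in N, forall x, a x = x} -> c \in N -> #[c] = p -> a g = g * c ->
  #[a] = p.
Proof.
move=> p_pr AutGa defG fixN Nc oc ag.
have Gg : g \in G by rewrite defG mem_gen // setU11.
have sNG : N \subset G by rewrite defG sub_gen ?subsetUr.
have iter_ag k : iter k a g = g * c ^+ k.
  elim: k => [|k IHk]; first by rewrite mulg1.
  rewrite iterS IHk (morphicP (Aut_morphic AutGa)) ?groupX ?(subsetP sNG c) //.
  by rewrite ag fixN ?groupX // expgS mulgA.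
apply: nt_prime_order => //; last first.
  apply: contra_eq_neq oc => a1; move/eqP: ag.
  rewrite a1 perm1 -{1}[g]mulg1 (inj_eq (mulgI g)) => /eqP <-.
  by rewrite order1 neq_ltn prime_gt1.
apply: (Aut_fix_gen_eq1 (groupX _ AutGa) defG) => x /setU1P[->|Nx].
  by rewrite permX iter_ag -oc expg_order mulg1.
by rewrite permX; elim: p {p_pr oc} => //= k ->; apply: fixN.
Qed.

Lemma Inn_conj (gT : finGroupType) (G : {group gT}) (a : {perm gT}) :
  a \in Inn G -> exists2 x, x \in G & {in G, forall y, a y = y ^ x}.
Proof. by case/morphimP=> x _ Gx ->; exists x => // y; apply: conj_autE. Qed.

(** Inner automorphisms act trivially on G / G^`(1). *)
Lemma Inn_shear_der1 (gT : finGroupType) (G : {group gT}) (g c : gT) (a : {perm gT}) :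
  a \in Inn G -> g \in G -> a g = g * c -> c \in G^`(1).
Proof.
case/Inn_conj=> x Gx def_a Gg; rewrite def_a // conjg_mulR => /mulgI <-.
exact: mem_commg.
Qed.

(** * Small second center: order at least p ^ 4 *)

(** Class c >= 2 forces order at least p ^ c.+1. For c >= 3 this bound applied to
    G / 'Z(G), of class c.-1, leaves only a factor p for 'Z(G). *)
Lemma card_center_maxclass (gT : finGroupType) (p : nat) (G : {group gT}) :
    prime p -> p.-group G -> ~~ abelian G ->
    (nil_class G).+1 = logn p #|G| ->
  #|'Z(G)| = p.
Proof.
move=> p_pr pG nabG clG.
(* In class 2 the order is p ^ 3, and G is extraspecial. *)
have [ltcl3 | cl_ge3] := ltnP (nil_class G) 3.
  have esG : extraspecial G by apply: (p3group_extraspecial pG); rewrite // -clG.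
  by apply: (card_center_extraspecial pG esG).
have nilG := pgroup_nil pG.
have pZ : p.-group 'Z(G) := pgroupS (center_sub G) pG.
have ntZ : 'Z(G) != 1.
  by rewrite center_nil_eq1 //; apply: contraNneq nabG => ->; apply: abelian1.
have [_ _ [k oZ]] := pgroup_pdiv pZ ntZ.
have := nil_class_pgroup (quotient_pgroup 'Z(G) pG).
rewrite nil_class_quotient_center // card_quotient ?gFnorm //.
have := congr1 (logn p) (Lagrange (center_sub G)).
rewrite lognM ?cardG_gt0 // -clG oZ pfactorK //.
case: k {oZ} => [|k]; first by rewrite expn1.
case: (nil_class G) cl_ge3 => [//|[//|[//|c]]] _ /=.
rewrite !addSn => -[kl]; rewrite leq_max /= ltn_predRL -kl ltnNge => /negP[].
exact: leq_addl.
Qed.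

(** The subgroup N is chosen to contain some x that does not commute with a
    representative y of a generator of 'Z(G / 'Z(G)). *)
Lemma maximal_cent_sub_center (gT : finGroupType) (p : nat) (G : {group gT}) :
    prime p -> p.-group G -> ~~ abelian G -> #|'Z(G / 'Z(G))| = p ->
  exists2 N : {group gT}, maximal N G & 'C_G(N) \subset 'Z(G).
Proof.
move=> p_pr pG nabG oZ2; set Z := 'Z(G) in oZ2 *.
have nZG : G \subset 'N(Z) := gFnorm _ G.
have: 'Z(G / Z) != 1 by rewrite -cardG_gt1 oZ2 prime_gt1.
case/trivgPn=> _ /setIP[/morphimP[y Ny Gy ->] cGy] nty.
have Z'y : y \notin Z by apply: contra nty => Zy; apply/eqP/coset_id.
have /subsetPn[x Gx c'yx]: ~~ (G \subset 'C[y]).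
  by apply: contra Z'y => cGy'; rewrite /Z /center inE Gy -sub_cent1.
have [N maxN xN] : exists2 N : {group gT}, maximal N G & <[x]> \subset N.
  have [|eqG|//] := @maximal_exists _ <[x]> G; first by rewrite cycle_subG.
  by case/negP: nabG; rewrite -eqG cycle_abelian.
exists N => //.
have /andP[sNG nNG] := p_maximal_normal pG maxN.
apply: contraR c'yx => nCZ.
have sZC : Z \subset 'C_G(N) by rewrite setIS ?centS.
have ntQ : 'C_G(N) / Z != 1.
  by rewrite -subG1 quotient_sub1 // (subset_trans (subsetIl _ _)).
have nsC : 'C_G(N) / Z <| G / Z.
  by rewrite quotient_normal // /normal subsetIl normsI ?normG ?norms_cent.
(* 'C_G(N) / Z is nontrivial and normal in the p-group G / Z, so it meets the
   center of that group, which has prime order and is therefore contained in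
   it. *)
have := meet_center_nil (quotient_nil _ (pgroup_nil pG)) nsC ntQ.
rewrite setIC => tiQ.
have sZQ : 'Z(G / Z) \subset 'C_G(N) / Z.
  apply: contraR tiQ => nsub; apply/eqP.
  by rewrite prime_TIg ?oZ2.
have : coset Z y \in 'C_G(N) / Z.
  by rewrite (subsetP sZQ) // inE mem_quotient.
rewrite -cycle_subG -quotient_cycle ?(subsetP nZG) // quotientSGK //; last first.
  by rewrite cycle_subG (subsetP nZG).
rewrite cycle_subG => /setIP[_ /centP cNy].
by apply/cent1P/commute_sym/cNy; rewrite -cycle_subG.
Qed.

(** The shear by a central element z of order p in N: an element inducing it by
    conjugation centralizes N, so it is central and would fix g as well. *)
Lemma noninner_center_quotient_center (gT : finGroupType) (p : nat) (G : {group gT}) :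
    prime p -> p.-group G -> ~~ abelian G -> #|'Z(G / 'Z(G))| = p ->
  exists a : {perm gT},
    [/\ a \in Aut G, a \notin Inn G, #[a] = p & elementwise_fixes a 'Phi(G)].
Proof.
move=> p_pr pG nabG oZ2.
have [N maxN sCZ] := maximal_cent_sub_center p_pr pG nabG oZ2.
have nsNG := p_maximal_normal pG maxN; have sNG := normal_sub nsNG.
have iNG := p_maximal_index pG maxN.
have ntN : N :!=: 1.
  apply: contraNneq nabG => N1; move: sCZ; rewrite N1 cent1T setIT subsetI.
  by case/andP.
have pNZ : p.-group (N :&: 'Z(G)) := pgroupS (subset_trans (subsetIl _ _) sNG) pG.
have [_ p_dv _] := pgroup_pdiv pNZ (meet_center_nil (pgroup_nil pG) nsNG ntN).
have [z /setIP[Nz /setIP[Gz cGz]] oz] := Cauchy p_pr p_dv.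
have [g Gg N'g] : exists2 g, g \in G & g \notin N.
  by have /maxgroupP[/proper_subn/subsetPn] := maxN.
have [||||a [AutGa fixN ag defG]] := @shear_Aut _ G N g z nsNG.
- by rewrite iNG.
- by rewrite inE N'g.
- by rewrite inE Nz (subsetP (centS sNG)).
- by rewrite iNG expgMn; [rewrite -oz expg_order mulg1 | apply/esym/(centP cGz)].
exists a; split=> //; last by move=> x /(subsetP (Phi_sub_max maxN)); apply: fixN.
  apply/negP=> /Inn_conj[x Gx def_a].
  have Zx : x \in 'Z(G).
    rewrite (subsetP sCZ) // inE Gx; apply/centP=> y Ny; apply/esym/commgP/conjg_fixP.
    by rewrite -def_a ?fixN ?(subsetP sNG).
  have /eqP := ag; rewrite def_a // /conjg.
  have [_ /centP/(_ g Gg) cxg] := setIP Zx.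
  rewrite -cxg mulKg -{1}[g]mulg1 (inj_eq (mulgI g)) => /eqP z1.
  by move: oz p_pr; rewrite -z1 order1 => <-.
exact: (order_shear p_pr AutGa defG fixN Nz oz ag).
Qed.

(** * Order p ^ 3 *)

(** A noncyclic p-group with p odd has an elementary abelian subgroup E of order
    p ^ 2, which is maximal here and is not contained in the center, of order p. *)
Lemma noninner_p3_odd (gT : finGroupType) (p : nat) (G : {group gT}) :
    prime p -> odd p -> ~~ abelian G -> #|G| = (p ^ 3)%N ->
  exists a : {perm gT},
    [/\ a \in Aut G, a \notin Inn G, #[a] = p & elementwise_fixes a 'Phi(G)].
Proof.
move=> p_pr odd_p nabG oG.
have pG : p.-group G by rewrite /pgroup oG pnatX pnat_id.
have esG : extraspecial G by apply: (p3group_extraspecial pG); rewrite // oG pfactorK.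
have [[_ defG'] _] := esG; have oZ := card_center_extraspecial pG esG.
have /p_rank_geP[E /pnElemP[sEG abelE rE]] : 1 < 'r_p(G).
  rewrite ltnNge -odd_pgroup_rank1_cyclic ?oG ?oddX ?odd_p ?orbT //.
  by apply: contra nabG; apply: cyclic_abelian.
have oE : #|E| = (p ^ 2)%N by rewrite (card_pgroup (abelem_pgroup abelE)) rE.
have iEG : #|G : E| = p by rewrite -divgS // oG oE -expnB ?prime_gt0 ?expn1.
have maxE : maximal E G by apply: p_index_maximal; rewrite ?iEG.
have /subsetPn[c Ec Z'c] : ~~ (E \subset 'Z(G)).
  apply/negP=> /subset_leq_card; rewrite oE oZ -{2}(expn1 p) leq_exp2l //.
  exact: prime_gt1.
have [g Gg E'g] : exists2 g, g \in G & g \notin E.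
  by have /maxgroupP[/proper_subn/subsetPn] := maxE.
have oc : #[c] = p.
  apply: (abelem_order_p abelE Ec).
  by apply: contraNneq Z'c => ->; apply: group1.
have Gc : c \in G := subsetP sEG c Ec.
have Zcg : [~ c, g] \in 'Z(G) by rewrite -defG' mem_commg.
have [_ /centP cGcg] := setIP Zcg.
have cgp : [~ c, g] ^+ p = 1 by have := expg_cardG Zcg; rewrite /= oZ.
have [||||a [AutGa fixE ag defG]] := @shear_Aut _ G E g c (p_maximal_normal pG maxE).
- by rewrite iEG.
- by rewrite inE E'g.
- by rewrite (center_idP (abelem_abelian abelE)).
(* (g * c) ^+ p = g ^+ p * c ^+ p * [~ c, g] ^+ 'C(p, 2), and both c and the
   central commutator are killed by p, which divides 'C(p, 2). *)
- rewrite iEG expMg_Rmul; try by apply/esym/cGcg.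
  rewrite -{2}oc expg_order mulg1.
  have /dvdnP[k ->] : p %| 'C(p, 2) by apply: prime_dvd_bin; rewrite ?odd_prime_gt2.
  by rewrite mulnC expgM cgp expg1n mulg1.
exists a; split=> //; last by move=> x /(subsetP (Phi_sub_max maxE)); apply: fixE.
  by apply: contra Z'c => Inn_a; rewrite -defG'; apply: Inn_shear_der1 ag.
exact: (order_shear p_pr AutGa defG fixE Ec oc ag).
Qed.

(** In the quaternion group every noncentral element has order 4, so no shear of
    order 2 is noninner. The shear s |-> s * r along a cyclic <[r]> of order 4
    becomes an involution once composed with the conjugation by s. *)
Lemma noninner_order8 (gT : finGroupType) (G : {group gT}) :
    ~~ abelian G -> #|G| = 8 ->
  exists a : {perm gT},
    [/\ a \in Aut G, a \notin Inn G, #[a] = 2 & elementwise_fixes a 'Phi(G)].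
Proof.
move=> nabG oG.
have pG : 2.-group G by rewrite /pgroup oG.
have esG : extraspecial G by apply: (p3group_extraspecial pG); rewrite // oG.
have [[defPhi defG'] _] := esG; have oZ := card_center_extraspecial pG esG.
have Zsq x : x \in G -> x ^+ 2 \in 'Z(G).
  by move=> Gx; rewrite -defPhi (Phi_joing pG) mem_gen // inE (Mho_p_elt 1) ?(mem_p_elt pG) ?orbT.
have [r Gr r2] : exists2 r, r \in G & r ^+ 2 != 1.
  apply/exists_inP; apply: contraR nabG => /exists_inPn expG.
  apply: (@abelem_abelian _ 2); apply/exponent2_abelem/exponentP=> x /expG.
  by rewrite negbK => /eqP.
have Z2 z : z \in 'Z(G) -> z ^+ 2 = 1 by move/expg_cardG; rewrite /= oZ.
have Z'r : r \notin 'Z(G) by apply: contra r2 => /Z2->.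
have /subsetPn[s Gs c'rs]: ~~ (G \subset 'C[r]).
  by apply: contra Z'r => cGr; rewrite /center inE Gr -sub_cent1.
have N's : s \notin <[r]>.
  by apply: contra c'rs; apply/subsetP; rewrite cycle_subG cent1id.
have or : #[r] = 4.
  have : #[r] %| 4 by rewrite order_dvdn (expgM r 2 2) Z2 ?Zsq.
  have : ~~ (#[r] %| 2) by rewrite order_dvdn.
  by case: #[r] (order_gt0 r) => [|[|[|[|[|k]]]]] // _ _ /dvdn_leq; apply: contraTeq.
(* Both [~ r, s] and r ^+ 2 are the nontrivial element of 'Z(G). *)
have def_rs : [~ r, s] = r ^+ 2.
  have Zrs : [~ r, s] \in 'Z(G) by rewrite -defG' mem_commg.
  have defZ : 'Z(G) = <[r ^+ 2]>.
    by apply: nt_gen_prime; [rewrite oZ | apply/setD1P; split; last exact: Zsq].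
  move: Zrs; rewrite defZ cycle2g; last by rewrite orderE -defZ.
  case/set2P=> // /eqP/commgP crs; case/negP: c'rs; apply/cent1P.
  exact: commute_sym.
have rs : r ^ s = r^-1.
  by rewrite conjg_mulR def_rs -expgS; apply: (mulgI r); rewrite -expgS mulgV -or expg_order.
have iNG : #|G : <[r]>| = 2 by rewrite -divgS ?cycle_subG // oG -orderE or.
have maxN : maximal <[r]> G by apply: p_index_maximal; rewrite ?iNG ?cycle_subG.
have [||||b [AutGb fixN bs defG]] := @shear_Aut _ G <[r]> s r (p_maximal_normal pG maxN).
- by rewrite iNG.
- by rewrite inE N's.
- by rewrite (center_idP (cycle_abelian r)) cycle_id.
- by rewrite iNG !expgS !expg0 !mulg1 -mulgA (mulgA r) (conjgC r s) rs mulgKV.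
pose a : {perm gT} := conj_aut G s * b.
have AutGs : conj_aut G s \in Aut G by rewrite Aut_aut.
have AutGa : a \in Aut G by rewrite groupM.
have aE x : x \in G -> a x = b (x ^ s) by move=> Gx; rewrite permM conj_autE.
have as_ : a s = s * r by rewrite aE // conjgE mulKg.
have ar : a r = r^-1 by rewrite aE // rs fixN // groupV cycle_id.
exists a; split=> //.
- by apply: contra Z'r => Inn_a; rewrite -defG'; apply: Inn_shear_der1 as_.
- apply: nt_prime_order => //; last first.
    apply: contraNneq r2 => a1; move/eqP: as_.
    rewrite a1 perm1 -{1}[s]mulg1 (inj_eq (mulgI s)) => /eqP <-.
    by rewrite expg1n.
  have defG2 : G :=: <<[set s; r]>>.
    by rewrite defG -[LHS]joingE -[RHS]joingE joing_idr.
  apply: (Aut_fix_gen_eq1 (groupX _ AutGa) defG2) => x.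
  case/set2P=> ->; rewrite expgS expg1 permM.
    by rewrite as_ (morphicP (Aut_morphic AutGa)) // as_ ar mulgK.
  by rewrite ar -(autmE AutGa) morphV //= autmE ar invgK.
move=> x; rewrite {1}defPhi => Zx; have [Gx /centP cGx] := setIP Zx.
rewrite aE // /conjg cGx // mulKg fixN //.
by rewrite (subsetP (Phi_sub_max maxN)) // defPhi.
Qed.

Theorem corollary2p4 (gT : finGroupType) (p : nat) (G : {group gT})
    (p_pr : prime p) (pG : p.-group G) (nabG : ~~ abelian G)
    (coclG : has_coclass p 1 G) :
  exists a : {perm gT},
    [/\ a \in Aut G, a \notin Inn G, #[a] = p & elementwise_fixes a 'Phi(G)].
Proof.
have [n [oG n_gt2 nilG]] := coclG; rewrite addn1 => clG.
have oZ : #|'Z(G)| = p.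
  by apply: card_center_maxclass => //; rewrite oG pfactorK.
have [n3 | n_gt3] := leqP n 3.
  have {n3}n3 : n = 3 by apply/eqP; rewrite eqn_leq n3.
  rewrite n3 in oG; have [p2 | odd_p] := even_prime p_pr; last exact: noninner_p3_odd.
  by move: oG; rewrite p2; apply: noninner_order8.
apply: noninner_center_quotient_center => //.
have clQ : nil_class (G / 'Z(G)) = n.-2.
  by rewrite nil_class_quotient_center // -clG.
apply: card_center_maxclass => //; first exact: quotient_pgroup.
  by rewrite -nil_class1 clQ -ltnNge; case: n n_gt3 {oG n_gt2 clG clQ} => [|[|[|[]]]].
rewrite clQ card_quotient ?gFnorm // -divgS ?center_sub // oG oZ.
by case: n n_gt3 {oG n_gt2 clG clQ} => [|[|n]] // _; rewrite expnS mulKn ?prime_gt0 ?pfactorK.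
Qed.
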